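(* Let $(f,G):E\to\mathbb{R}\times X$ be a $1$-jet defined on a nonempty subset $E$ of a Hilbert space $(X,|\cdot|)$. There exists $F\in C^{1,\omega}(X)$ with $(F,\nabla F)=(f,G)$ on $E$ if and only if $A(f,G)<\infty$, in which case $$A(f,G)\le\|(f,G)\|_{E,\omega}\le\frac{16}{\sqrt{15}}\,A(f,G),$$ where $$\|(f,G)\|_{E,\omega}=\inf\{M_\omega(\nabla H)\ :\ H\in C^{1,\omega}(X)\text{ and }(H,\nabla H)=(f,G)\text{ on }E\}.$$ Furthermore, if $\omega(t)=t^\alpha$ with $0<\alpha\le1$, then (in that case) $$A(f,G)\le\|(f,G)\|_{E,\omega}\le\frac{2^{2-2\alpha}}{\sqrt{1+\alpha}}\left(1+\frac1\alpha\right)^{\alpha/2}A(f,G).$$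
   Context: Spaces are real. $\omega:[0,\infty)\to[0,\infty)$ is a modulus of continuity: a concave, increasing, continuous function with $\omega(0)=0$ and $\lim_{t\to\infty}\omega(t)=\infty$. Put $\varphi(t)=\int_0^t\omega(s)\,ds$ for $t\ge0$. A $1$-jet on $E\subseteq X$ is a pair of functions $f:E\to\mathbb{R}$, $G:E\to X$ (the dual of $X$ is identified with $X$). $C^{1,\omega}(X)$ is the set of Fréchet differentiable $g:X\to\mathbb{R}$ for which there is a constant $C>0$ with $|\nabla g(x)-\nabla g(y)|\le C\,\omega(|x-y|)$ for all $x,y\in X$. For $H\in C^{1,\omega}(X)$, $M_\omega(\nabla H)=\sup_{x\ne y}\frac{|\nabla H(x)-\nabla H(y)|}{\omega(|x-y|)}$. For a $1$-jet $(f,G)$ on $E$, $$A(f,G)=\sup_{x\in X;\ y,z\in E,\ |x-y|+|x-z|>0}\frac{|f(y)+\langle G(y),x-y\rangle-f(z)-\langle G(z),x-z\rangle|}{\varphi(|x-y|)+\varphi(|x-z|)}\in[0,\infty].$$ *)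

(* Defs.v *)
From mathcomp Require Export all_boot all_order all_algebra.
From mathcomp Require Export all_classical all_reals all_analysis.
From mathcomp Require Export sesquilinear.
Export Order.TTheory GRing.Theory Num.Theory numFieldNormedType.Exports.

Set Implicit Arguments.
Unset Strict Implicit.
Unset Printing Implicit Defensive.

Local Open Scope classical_set_scope.
Local Open Scope ring_scope.

Section modulus.
Context {R : realType}.
Implicit Types w : R -> R.

(* A modulus is a function on [0, +oo[; the values of [w] at negative arguments
   are irrelevant. *)
Definition is_modulus w : Prop :=
  [/\ forall t, 0 <= t -> 0 <= w t,
      convex_function (`[0, +oo[ : set R^o) (fun t => - w t),
      {in `[0, +oo[ &, {homo w : s t / s <= t}},
      {within `[0, +oo[, continuous w} &
      w 0 = 0 /\ w t @[t --> +oo] --> +oo].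

Definition phi w (t : R) : R := \int[lebesgue_measure]_(s in `[0, t]) w s.

End modulus.

(* Supremum of a set of elements of [0, +oo], computed in [0, +oo]: the
   supremum of the empty set is 0 ([ereal_sup set0] is -oo). The index sets
   below are empty when the space is trivial. *)
Definition sup0 {R : realType} (S : set (\bar R)) : \bar R :=
  ereal_sup (0%E |` S).

(* A Hilbert space is a complete normed space [X] with a positive definite
   symmetric bilinear form [dot] that induces its norm. *)
Definition induces_norm {R : realType} {X : completeNormedModType R}
  (dot : {dot X for idfun}) : Prop := forall x : X, `|x| ^+ 2 = dot x x.

Section jets.
Context {R : realType} {X : completeNormedModType R}.
Variables (dot : {dot X for idfun}) (w : R -> R).
Implicit Types (H f : X -> R) (G : X -> X) (E : set X).

(* The vector that represents the Frechet derivative of [H] at [x]. *)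
Definition grad H (x : X) : X :=
  get [set v : X | forall h : X, 'd H x h = dot v h].

Definition C1w H : Prop :=
  (forall x, differentiable H x) /\
  exists2 C : R, 0 < C &
    forall x y, `|grad H x - grad H y| <= C * w `|x - y|.

Definition Mw H : \bar R :=
  sup0 [set r | exists x y : X,
    x <> y /\ r = (`|grad H x - grad H y| / w `|x - y|)%:E].

(* A jet on [E] is given by functions on [X]; only their values on [E] are
   used. *)
Definition jet_on E H f G : Prop :=
  forall x, E x -> H x = f x /\ grad H x = G x.

Definition Ajet E f G : \bar R :=
  sup0 [set r | exists x y z : X,
    [/\ E y, E z, 0 < `|x - y| + `|x - z| &
      r = (`|f y + dot (G y) (x - y) - f z - dot (G z) (x - z)|
            / (phi w `|x - y| + phi w `|x - z|))%:E]].

Definition jet_norm E f G : \bar R :=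
  ereal_inf [set Mw H | H in [set H | C1w H /\ jet_on E H f G]].

End jets.

(* Main.v *)
Require Import Defs.
From HB Require Import structures.
From mathcomp Require Import ring lra.

Set Implicit Arguments.
Unset Strict Implicit.
Unset Printing Implicit Defensive.

Local Open Scope classical_set_scope.
Local Open Scope ring_scope.

(** The lower bound is Taylor's formula: if the gradient of [H] has modulus
    [M * w], integrating it along segments gives
    |H x - H y - <grad H y, x - y>| <= M phi |x - y| ([taylor_of_gradient_le]),
    and two such expansions of [H x], around [y] and around [z], bound the
    quotients that define [Ajet].

    For the converse let [a] be the value of [Ajet] and consider, for [e] in
    [E], the functions f e + <G e, x - e> + a phi |x - e| and
    f e + <G e, x - e> - a phi |x - e|. The definition of [a] says that every
    lower function lies below every upper one; a function squeezed between them
    has the prescribed jet on [E]. The function [x |-> phi |x|] is paraconcave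
    with error [K phi] ([phi_norm_paraconcave]), where [K] only depends on how
    [w] behaves under doubling. The extension is the supremum [envelope] of all
    functions that lie below the upper ones and are paraconvex with error
    [a K phi]. It is paraconvex, as a supremum of such functions. It is also
    paraconcave ([envelope_paraconcave]): an average of its translates, minus the
    error, is paraconvex and, because the upper functions are paraconcave, lies
    below them, hence is one of the competitors in the supremum.

    A function that is both paraconvex and paraconcave is almost affine at small
    scales. Its difference quotients therefore converge, the limit is linear, and
    Taylor's formula holds with error [a K phi] ([taylor_vector]); the
    representation theorem of Riesz turns the limit into a gradient. Finally,
    expanding the values at the two endpoints of a segment centred at the midpoint
    of [x] and [y], both around [x] and around [y], bounds the difference of the
    gradients at [x] and [y] ([gradient_le]); the errors are controlled by the
    concavity of [phi] in the squared norm and the parallelogram law. This costs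
    another constant [c], and the norm of the extension is at most [K * c * a].

    In general [K = 2] and [c = 8 / sqrt 15]; for [w t = t ^ p] one has
    [K = 2 ^ (1 - p)] and
    [c = 2 ^ (1 - p) / sqrt (1 + p) * (1 + 1 / p) ^ (p / 2)]. *)

(** * Moduli of continuity and their primitives *)
Section modulus_theory.
Context {R : realType}.
Variable w : R -> R.
Hypothesis hw : is_modulus w.
Implicit Types a b p q s t : R.

Lemma ler_sub_of_derive_within (u v du dv : R -> R) a b : a <= b ->
  (forall x, a < x < b -> is_derive x 1 u (du x)) ->
  (forall x, a < x < b -> is_derive x 1 v (dv x)) ->
  (forall x, a < x < b -> du x <= dv x) ->
  {within `[a, b], continuous u} -> {within `[a, b], continuous v} ->
  u b - u a <= v b - v a.
Proof.
rewrite le_eqVlt => /predU1P[->|ab] ud vd uv uc vc; first by rewrite !subrr.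
have d x : x \in `]a, b[%R -> is_derive x 1 (v - u) (dv x - du x).
  by rewrite in_itv => /= xab; apply: is_deriveB; [exact: vd|exact: ud].
have c : {within `[a, b], continuous (v - u)}.
  by move=> x; apply: cvgB; [exact: vc|exact: uc].
have [x xab E] := MVT ab d c.
have : 0 <= (v - u) b - (v - u) a.
  by rewrite E mulr_ge0 ?subr_ge0 ?(ltW ab)// uv.
rewrite !fctE; lra.
Qed.

Lemma ler_sub_of_derive (u v du dv : R -> R) a b : a <= b ->
  (forall x, a < x < b -> is_derive x 1 u (du x)) ->
  (forall x, a < x < b -> is_derive x 1 v (dv x)) ->
  (forall x, a < x < b -> du x <= dv x) ->
  continuous u -> continuous v -> u b - u a <= v b - v a.
Proof.
move=> ab ud vd uv uc vc.
by apply: (ler_sub_of_derive_within ab ud vd uv); exact: continuous_subspaceT.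
Qed.

Lemma modulus0 : w 0 = 0. Proof. by case: hw => _ _ _ _ []. Qed.

Lemma modulus_ge0 t : 0 <= t -> 0 <= w t. Proof. by case: hw => + _ _ _ _; exact. Qed.

Lemma modulus_le s t : 0 <= s -> s <= t -> w s <= w t.
Proof.
move=> s0 st; case: hw => _ _ h _ _; apply: h => //; rewrite in_itv/= andbT //.
exact: le_trans st.
Qed.

Lemma modulus_concave l p q : 0 <= l -> l <= 1 -> 0 <= p -> 0 <= q ->
  l * w p + (1 - l) * w q <= w (l * p + (1 - l) * q).
Proof.
move=> l0 l1 p0 q0; case: hw => _ h _ _ _.
have lI : Itv.spec (@Itv.num_sem R) (Itv.Real `[0%Z, 1%Z]) l.
  by rewrite /Itv.spec /= /Itv.num_sem /= in_itv /= num_real l0 l1.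
have := h (Itv.mk lI) p q; rewrite !inE /= !in_itv /= !andbT => /(_ p0 q0).
rewrite -[X in X <= _]/(- w (l * p + (1 - l) * q)).
by rewrite -[X in _ <= X]/(l * - w p + (1 - l) * - w q) => H; lra.
Qed.

(** The graph of [w] is concave and starts at the origin, so the slopes [w t / t]
    of its chords decrease; denominators are cleared. *)
Lemma modulus_ratio s t : 0 < s -> s <= t -> s * w t <= t * w s.
Proof.
move=> s0 st; have t0 : 0 < t by exact: lt_le_trans st.
have := @modulus_concave (s / t) t 0; rewrite modulus0 !mulr0 !addr0 divfK ?gt_eqF//.
rewrite divr_ge0 ?(ltW s0) ?(ltW t0)// ler_pdivrMr// mul1r => /(_ isT st isT (lexx _)).
by rewrite mulrAC ler_pdivrMr// [w s * t]mulrC.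
Qed.

(** [w] is positive somewhere because it tends to infinity, and [modulus_ratio]
    carries positivity down to every smaller argument. *)
Lemma modulus_gt0 t : 0 < t -> 0 < w t.
Proof.
move=> t0; case: hw => _ _ _ _ [_ /cvgry_gt /(_ 0) wpos].
have [s [ts ws]] := filter_ex (filterI (nbhs_pinfty_gt (num_real t)) wpos).
rewrite -(pmulr_rgt0 _ (lt_trans t0 ts)).
apply: lt_le_trans (modulus_ratio t0 (ltW ts)); exact: mulr_gt0.
Qed.

Lemma modulus_continuous t : 0 < t -> {for t, continuous w}.
Proof.
move=> t0; case: hw => _ _ _ wc _.
have : {within `]0, +oo[, continuous w}.
  by apply: continuous_subspaceW wc; apply: subset_itvr; rewrite bnd_simp.
rewrite continuous_open_subspace; last exact: interval_open.
by apply; rewrite inE /= in_itv/= t0.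
Qed.

Lemma modulus_integrable u :
  (@lebesgue_measure R).-integrable `[0, u] (EFin \o w).
Proof.
apply: continuous_compact_integrable; first exact: segment_compact.
case: hw => _ _ _ wc _; apply: continuous_subspaceW wc.
by apply: subset_itvl; rewrite bnd_simp.
Qed.

Lemma phi0 : phi w 0 = 0.
Proof. by rewrite /phi set_itv1 Rintegral_set1. Qed.

Lemma phi_is_derive t : 0 < t -> is_derive t 1 (phi w) (w t).
Proof.
move=> t0.
have [||||h1 h2] := @continuous_FTC1_closed R w 0 t (t + 1).
- by rewrite ltrDl.
- exact: modulus_integrable.
- exact: t0.
- exact: modulus_continuous.
split; first exact: h1.
have h3 : derive1 (phi w) t = w t := h2.
by rewrite -h3 derive1E.
Qed.

(** [phi w] vanishes on the negative half-line, so continuity holds on the whole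
    line and comparisons on [[0, b]] need no one-sided argument. *)
Lemma phi_continuous : continuous (phi w).
Proof.
move=> t; have [t0|t0|->] := ltgtP t 0.
- apply: (near_cst_continuous 0); near=> x; rewrite /phi set_itv_ge ?Rintegral_set0//.
  rewrite bnd_simp -ltNge; near: x; exact: lt_nbhsl.
- by apply: differentiable_continuous; apply/derivable1_diffP; case: (phi_is_derive t0).
- rewrite /continuous_at phi0.
  exact: (parameterized_integral_cvg_left ltr01 (@modulus_integrable 1)).
Unshelve. all: by end_near. Qed.

Lemma mull_continuous (c : R) : continuous (fun x : R => c * x).
Proof. by move=> x; exact: mulrl_continuous. Qed.

Lemma mull_is_derive (c x : R) : is_derive x 1 (fun x : R => c * x) c.
Proof.
have := @is_deriveZ R R R id c x 1 1 (is_derive_id x 1).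
by rewrite [_ *: _]mulr1.
Qed.

Lemma sqr_is_derive (c x : R) : is_derive x 1 (fun x : R => c * x ^+ 2) (2 * c * x).
Proof.
have -> : (fun x : R => c * x ^+ 2) = c \*: (id ^+ 2) by apply/funext => y.
apply: is_derive_eq; rewrite -[LHS]/(c * (2%:R * x ^+ 1 * 1)); ring.
Qed.

Lemma phi_sub_ge a b : 0 <= a -> a <= b -> (b - a) * w a <= phi w b - phi w a.
Proof.
move=> a0 ab; have -> : (b - a) * w a = w a * b - w a * a by ring.
apply: (@ler_sub_of_derive _ _ (fun=> w a) w) => //.
- by move=> x _; exact: mull_is_derive.
- by move=> x /andP[ax _]; apply: phi_is_derive; exact: le_lt_trans ax.
- by move=> x /andP[ax _]; apply: modulus_le => //; exact: ltW.
- exact: mull_continuous.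
- exact: phi_continuous.
Qed.

Lemma phi_sub_le a b : 0 <= a -> a <= b -> phi w b - phi w a <= (b - a) * w b.
Proof.
move=> a0 ab; have -> : (b - a) * w b = w b * b - w b * a by ring.
apply: (@ler_sub_of_derive _ _ w (fun=> w b)) => //.
- by move=> x /andP[ax _]; apply: phi_is_derive; exact: le_lt_trans ax.
- by move=> x _; exact: mull_is_derive.
- move=> x /andP[ax xb]; apply: modulus_le => //; last exact: ltW.
  exact: le_trans (ltW ax).
- exact: phi_continuous.
- exact: mull_continuous.
Qed.

Lemma phi_le a b : 0 <= a -> a <= b -> phi w a <= phi w b.
Proof.
move=> a0 ab; rewrite -subr_ge0; apply: le_trans (phi_sub_ge a0 ab).
by rewrite mulr_ge0 ?subr_ge0// modulus_ge0.
Qed.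

Lemma phi_ge0 a : 0 <= a -> 0 <= phi w a.
Proof. by rewrite -[X in X <= phi w a]phi0; exact: phi_le. Qed.

Lemma phi_le_mul t : 0 <= t -> phi w t <= t * w t.
Proof. by move=> t0; have := phi_sub_le (lexx 0) t0; rewrite phi0 !subr0. Qed.

(** Since [w t / t] decreases, [r |-> phi w (sqrt r)] is concave with slope
    [w s / (2 * s)] at [r = s ^+ 2], and its graph lies below this tangent. All
    Hilbert space estimates of [phi w `|x|] come from here, as [`|x| ^+ 2] is a
    polynomial in scalar products. *)
Lemma phi_tangent s p : 0 < s -> 0 <= p ->
  phi w p <= phi w s + w s / (2 * s) * (p ^+ 2 - s ^+ 2).
Proof.
move=> s0 p0; set c := w s / (2 * s).
pose q x := c * x ^+ 2.
have qd (x : R) : is_derive x 1 q (w s / s * x).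
  have -> : w s / s * x = 2 * c * x by rewrite /c; field; rewrite gt_eqF.
  exact: sqr_is_derive.
have qc : continuous q.
  by move=> x; apply: differentiable_continuous; apply/derivable1_diffP; case: (qd x).
have Eq : c * (p ^+ 2 - s ^+ 2) = q p - q s by rewrite /q; ring.
rewrite -lerBlDl Eq; have [sp|ps] := leP s p.
- apply: (@ler_sub_of_derive _ _ w (fun x => w s / s * x)) => //.
  + by move=> x /andP[sx _]; apply: phi_is_derive; exact: lt_trans sx.
  + move=> x /andP[sx _]; rewrite mulrAC ler_pdivlMr// mulrC [w s * x]mulrC.
    by apply: modulus_ratio => //; exact: ltW.
  + exact: phi_continuous.
- rewrite -lerN2 !opprB.
  apply: (@ler_sub_of_derive _ _ (fun x => w s / s * x) w) => //; first exact: ltW.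
  + by move=> x /andP[px _]; apply: phi_is_derive; exact: le_lt_trans px.
  + move=> x /andP[px xs]; rewrite mulrAC ler_pdivrMr// [w s * x]mulrC [w x * s]mulrC.
    apply: modulus_ratio; [exact: le_lt_trans px|exact: ltW].
  + exact: phi_continuous.
Qed.

Lemma phi_ge_half t : 0 <= t -> t * w t <= 2 * phi w t.
Proof.
rewrite le_eqVlt => /predU1P[<-|t0]; first by rewrite phi0 mul0r mulr0.
have := phi_tangent t0 (lexx 0); rewrite phi0.
have -> : w t / (2 * t) * (0 ^+ 2 - t ^+ 2) = - (t * w t / 2).
  by field; rewrite gt_eqF.
lra.
Qed.

Lemma phi_gt0 t : 0 < t -> 0 < phi w t.
Proof.
move=> t0; have := phi_ge_half (ltW t0); have := mulr_gt0 t0 (modulus_gt0 t0); lra.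
Qed.

Lemma phi_affine_is_derive (a e x : R) : 0 < a + e * x ->
  is_derive x 1 (fun x => phi w (a + e * x)) (e * w (a + e * x)).
Proof.
move=> h; rewrite mulrC.
apply: (@is_derive1_comp _ (phi w) (fun x => a + e * x)).
  exact: phi_is_derive.
have := @is_deriveD R R R (cst a) _ x 1 0 e (is_derive_cst a x 1) (mull_is_derive e x).
by rewrite add0r.
Qed.

Lemma phi_affine_continuous (a e : R) : continuous (fun x => phi w (a + e * x)).
Proof.
move=> x; apply: (@continuous_comp _ _ _ (fun x => a + e * x) (phi w)); last exact: phi_continuous.
by apply: cvgD; [exact: cvg_cst|exact: mull_continuous].
Qed.

(** Concavity at [d] balances [w (d + x)] against [w (d - x)]. *)
Lemma phi_double d : 0 <= d -> phi w (2 * d) <= 2 * d * w d.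
Proof.
move=> d0.
have := @ler_sub_of_derive
  (fun x => phi w (d + 1 * x) - phi w (d + (-1) * x)) (fun x => 2 * w d * x)
  (fun x => 1 * w (d + 1 * x) - (-1) * w (d + (-1) * x)) (fun=> 2 * w d) 0 d d0.
rewrite !mul1r !mulN1r !mulr0 oppr0 !addr0 !subrr !subr0 phi0 subr0.
have -> : d + d = 2 * d by ring.
have -> : 2 * w d * d = 2 * d * w d by ring.
apply.
- move=> x /andP[x0 xd]; apply: is_deriveB; apply: phi_affine_is_derive; lra.
- by move=> x _; exact: mull_is_derive.
- move=> x /andP[x0 xd].
  have := @modulus_concave (1/2) (d + x) (d - x).
  rewrite (_ : 1 / 2 * (d + x) + (1 - 1 / 2) * (d - x) = d); last by field.
  move=> h; have : 1 / 2 * w (d + x) + (1 - 1 / 2) * w (d - x) <= w d.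
    by apply: h; lra.
  rewrite !mul1r !mulN1r; lra.
- by move=> x; apply: cvgB; exact: phi_affine_continuous.
- exact: mull_continuous.
Qed.

(** By concavity of [w], such a [K] also satisfies [w p + w q <= K * w (p + q)].
    For two opposite vectors of norm [t / 2] the condition is a Hoelder condition,
    relative to [w], on the gradient [w `|x| / `|x| *: x] of [x |-> phi w `|x|]. *)
Definition doubling_const (K : R) := forall t, 0 <= t -> 2 * w (t / 2) <= K * w t.

Variable K : R.
Hypothesis hK : doubling_const K.

Lemma modulus_add_le p q : 0 <= p -> 0 <= q -> w p + w q <= K * w (p + q).
Proof.
move=> p0 q0; have h := @hK (p + q) (addr_ge0 p0 q0).
have := @modulus_concave (1/2) p q.
rewrite (_ : 1 / 2 * p + (1 - 1 / 2) * q = (p + q) / 2); last by field.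
move=> h'; have : 1 / 2 * w p + (1 - 1 / 2) * w q <= w ((p + q) / 2).
  by apply: h'; lra.
lra.
Qed.

Lemma phi_half t : 0 <= t -> 4 * phi w (t / 2) <= K * phi w t.
Proof.
move=> t0.
have := @ler_sub_of_derive
  (fun x => 4 * phi w (0 + (1/2) * x)) (fun x => K * phi w x)
  (fun x => 4 * ((1/2) * w (0 + (1/2) * x))) (fun x => K * w x) 0 t t0.
rewrite !mulr0 addr0 phi0 !mulr0 !subr0 !add0r.
rewrite [1 / 2 * t]mulrC mulrA mulr1; apply.
- move=> x /andP[x0 xd]; apply: (@is_deriveZ R R R _ 4).
  by apply: phi_affine_is_derive; lra.
- by move=> x /andP[x0 _]; apply: (@is_deriveZ R R R _ K); exact: phi_is_derive.
- move=> x /andP[x0 _]; have := hK (ltW x0).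
  by rewrite add0r (_ : 1 / 2 * x = x / 2); [lra|ring].
- move=> x; apply: cvgM; first exact: cvg_cst.
  exact: phi_affine_continuous.
- move=> x; apply: cvgM; first exact: cvg_cst.
  exact: phi_continuous.
Qed.

(** Integrating the doubling condition bounds [K * phi w t] below by
    [4 * phi w (t / 2)], and the triangle below the graph of [w] on
    [[0, t / 2]] bounds that by [t * w (t / 2)]. *)
Lemma modulus_half_le_phi t : 0 <= t -> t * w (t / 2) <= K * phi w t.
Proof.
move=> t0; apply: le_trans (phi_half t0).
have := @phi_ge_half (t / 2); rewrite divr_ge0// => /(_ isT); lra.
Qed.

(** This is [phi_norm_supergradient] for two vectors of norms [r] and [p] that
    point in opposite directions. In [p] the derivatives of the two sides,
    [w (p - r) + w r] and [K * w p], are ordered by [modulus_add_le]; it remains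
    to compare at [p = 2 * r]. *)
Lemma phi_reflect r p : 0 <= r -> 2 * r <= p ->
  phi w (p - r) + w r * p <= phi w r + K * phi w p.
Proof.
move=> r0 rp.
have : 2 * r * w r <= K * phi w (2 * r).
  have h : 2 * r / 2 = r by field.
  by rewrite -[in w r]h; apply: modulus_half_le_phi; lra.
have := @ler_sub_of_derive
  (fun x => phi w (- r + 1 * x) + w r * x) (fun x => K * phi w x)
  (fun x => 1 * w (- r + 1 * x) + w r) (fun x => K * w x) (2 * r) p rp.
rewrite !mul1r ![- r + _]addrC (_ : 2 * r - r = r); last by ring.
move=> h1 h2; suff : phi w (p - r) + w r * p - (phi w r + w r * (2 * r)) <=
     K * phi w p - K * phi w (2 * r) by lra.
apply: h1.
- move=> x /andP[x0 xd]; apply: is_deriveD; last exact: mull_is_derive.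
  by apply: phi_affine_is_derive; lra.
- move=> x /andP[x0 _]; apply: (@is_deriveZ R R R _ K); apply: phi_is_derive; lra.
- move=> x /andP[x0 _]; have := @modulus_add_le (x - r) r.
  rewrite subrK => h; rewrite mul1r [- r + _]addrC mul1r; apply: h; lra.
- move=> x; apply: cvgD; last exact: mull_continuous.
  exact: phi_affine_continuous.
- move=> x; apply: cvgM; first exact: cvg_cst.
  exact: phi_continuous.
Qed.

End modulus_theory.

(** * Scalar products and the Riesz representation *)
Section hilbert.
Context {R : realType} {X : completeNormedModType R}.
Variable dot : {dot X for idfun}.
Hypothesis hdot : induces_norm dot.
Implicit Types x y z h k u v : X.

Lemma dotC u v : dot u v = dot v u.
Proof. by rewrite hermC expr0 mul1r. Qed.

Lemma dotDr u v h : dot u (v + h) = dot u v + dot u h.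
Proof. exact: linearDr. Qed.

Lemma dotDl u v h : dot (u + v) h = dot u h + dot v h.
Proof. exact: linearDl. Qed.

Lemma dotNr u v : dot u (- v) = - dot u v.
Proof. exact: linearNr. Qed.

Lemma dotBr u v h : dot u (v - h) = dot u v - dot u h.
Proof. exact: linearBr. Qed.

Lemma dotBl u v h : dot (u - v) h = dot u h - dot v h.
Proof. exact: linearBl. Qed.

Lemma dotZr (a : R) u v : dot u (a *: v) = a * dot u v.
Proof. exact: linearZr_LR. Qed.

Lemma dotZl (a : R) u v : dot (a *: u) v = a * dot u v.
Proof. by rewrite dotC dotZr dotC. Qed.

Lemma norm_sqD u v : `|u + v| ^+ 2 = `|u| ^+ 2 + `|v| ^+ 2 + 2 * dot u v.
Proof. by rewrite !hdot dotDr !dotDl (dotC v u); ring. Qed.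

Lemma norm_sqB u v : `|u - v| ^+ 2 = `|u| ^+ 2 + `|v| ^+ 2 - 2 * dot u v.
Proof. by rewrite !hdot dotBr !dotBl (dotC v u); ring. Qed.

Lemma parallelogram u v :
  `|u + v| ^+ 2 + `|u - v| ^+ 2 = 2 * (`|u| ^+ 2 + `|v| ^+ 2).
Proof. by rewrite norm_sqD norm_sqB; ring. Qed.

Lemma dot_le u v : dot u v <= `|u| * `|v|.
Proof.
have [->|u0] := eqVneq u 0; first by rewrite linear0l normr0 mul0r.
have [->|v0] := eqVneq v 0; first by rewrite linear0r normr0 mulr0.
have p : 0 < `|u| * `|v| by rewrite mulr_gt0 ?normr_gt0.
have : 0 <= `| `|v| *: u - `|u| *: v| ^+ 2 by exact: sqr_ge0.
rewrite norm_sqB !normrZ !normr_id dotZl dotZr !exprMn => h.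
rewrite -subr_ge0 -(pmulr_rge0 _ p).
lra.
Qed.

Lemma dot_norm_le u v : `|dot u v| <= `|u| * `|v|.
Proof.
rewrite ler_norml dot_le andbT lerNl -mulN1r -dotZl.
by apply: le_trans (dot_le _ _) _; rewrite scaleN1r normrN.
Qed.

Lemma dot_inj u v : (forall h, dot u h = dot v h) -> u = v.
Proof.
move=> uv; apply/eqP; rewrite -subr_eq0 -normr_eq0 -sqrf_eq0 hdot.
by rewrite dotBl uv subrr.
Qed.

(** Any point where [`|x| ^+ 2 - 2 * L x] is minimal represents [L]. By the
    parallelogram law near-minimisers are close to each other, so the sublevel
    sets generate a Cauchy filter; [v] is its limit. *)
Lemma riesz (L : X -> R) (C : R) : (forall u v, L (u + v) = L u + L v) ->
  (forall (a : R) u, L (a *: u) = a * L u) -> (forall u, `|L u| <= C * `|u|) ->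
  exists v, forall h, L h = dot v h.
Proof.
move=> LD LZ LC; pose J x := `|x| ^+ 2 - 2 * L x.
have JlbE x : - C ^+ 2 <= J x.
  have := LC x; rewrite ler_norml => /andP[_ h].
  have := sqr_ge0 (`|x| - C); rewrite /J sqrrB; lra.
pose d := inf (range J).
have hinf : has_inf (range J).
  split; first by exists (J 0), 0.
  by exists (- C ^+ 2) => _ [x _ <-].
have Jd x : d <= J x by apply: inf_lbound; [case: hinf|exists x].
have Jmid x y : J x + J y = 2 * J (2^-1 *: (x + y)) + `|x - y| ^+ 2 / 2.
  have := parallelogram x y.
  by rewrite /J LZ LD normrZ exprMn ger0_norm ?invr_ge0//; lra.
pose S e := [set x | J x <= d + e].
pose F := filter_from [set e : R | 0 < e] S.
have FF : ProperFilter F.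
  apply: filter_from_proper; last first.
    move=> e e0; have [_ [x _ <-] xe] := inf_adherent e0 hinf.
    by exists x; exact: ltW.
  apply: filter_from_filter; first by exists 1 => /=.
  move=> e1 e2 /= e10 e20; exists (Num.min e1 e2) => /=; first by rewrite lt_min e10.
  move=> x Jx; split; apply: le_trans Jx _; rewrite lerD2l ge_min lexx ?orbT//.
have FC : cauchy F.
  apply: cauchy_exP => e e0.
  have e20 : 0 < e ^+ 2 / 8 by rewrite divr_gt0// exprn_gt0.
  have [_ [x _ <-] xe] := inf_adherent e20 hinf.
  exists x; exists (e ^+ 2 / 8) => //= y Jy.
  rewrite -ball_normE /=.
  rewrite -(@ltr_pXn2r _ 2)// ?nnegrE ?(ltW e0)//.
  have := Jmid x y; have := Jd (2^-1 *: (x + y)); move: xe Jy.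
  rewrite -/d /S /= => h1 h2 h3 h4.
  have := exprn_gt0 2 e0; lra.
have Fv : F --> lim F by exact: cauchy_cvg.
set v := lim F in Fv; exists v => h.
have bnd e : 0 < e -> `|dot v h - L h| <= e * (`|h| + (`|h| ^+ 2 + 1) / 2).
  move=> e0.
  have Fb : F (ball v e) by apply: Fv; exact: nbhsx_ballx.
  have Fe : F (S (e ^+ 2)) by exists (e ^+ 2) => //=; exact: exprn_gt0.
  have [x [xb Jx]] := filter_ex (filterI Fb Fe).
  (* Moving the near-minimiser x along h cannot lower J by more than e ^+ 2;
     the steps e and - e give the two sides of the bound. *)
  have Jt t : 0 <= 2 * t * (dot x h - L h) + t ^+ 2 * `|h| ^+ 2 + e ^+ 2.
    have := Jd (x + t *: h); move: Jx; rewrite /S /= /J norm_sqD LD LZ dotZr normrZ.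
    rewrite exprMn real_normK ?num_real// => h1 h2; lra.
  have h1 : `|dot x h - L h| <= e * ((`|h| ^+ 2 + 1) / 2).
    rewrite ler_norml; apply/andP; split.
      have := Jt e => h1; have : 0 <= e * (2 * (dot x h - L h) + e * (`|h| ^+ 2 + 1)).
        apply: le_trans h1 _; rewrite le_eqVlt; apply/orP; left; apply/eqP; ring.
      by rewrite pmulr_rge0//; lra.
    have := Jt (- e) => h1; have : 0 <= e * (2 * (L h - dot x h) + e * (`|h| ^+ 2 + 1)).
      apply: le_trans h1 _; rewrite le_eqVlt; apply/orP; left; apply/eqP; ring.
    by rewrite pmulr_rge0//; lra.
  have h2 : `|dot (v - x) h| <= e * `|h|.
    apply: le_trans (dot_norm_le _ _) _; rewrite ler_wpM2r//; apply: ltW.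
    by move: xb; rewrite -ball_normE.
  rewrite (_ : dot v h - L h = dot (v - x) h + (dot x h - L h)); last by rewrite dotBl; ring.
  apply: le_trans (ler_normD _ _) _; rewrite mulrDr; exact: lerD.
apply/esym/eqP; rewrite -subr_eq0 -normr_le0; apply/ler_addgt0Pl => e e0.
rewrite addr0; set c := `|h| + (`|h| ^+ 2 + 1) / 2.
have c0 : 0 < c.
  by rewrite /c ltr_wpDl// divr_gt0// ltr_wpDl// sqr_ge0.
by have := bnd (e / c) (divr_gt0 e0 c0); rewrite divfK// gt_eqF.
Qed.

End hilbert.

(** * Taylor expansions and gradients *)
Section smooth.
Context {R : realType} {X : completeNormedModType R}.
Variable dot : {dot X for idfun}.
Hypothesis hdot : induces_norm dot.
Variable w : R -> R.
Hypothesis hw : is_modulus w.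
Implicit Types x y z h k u v : X.

Lemma modulus_small e : 0 < e -> exists2 d, 0 < d & forall t, 0 <= t -> t < d -> w t <= e.
Proof.
move=> e0; case: (hw) => _ _ _ wc _.
have : w t @[t --> 0^'+] --> w 0.
  have ab : (0 : R) < 1 by [].
  have /(continuous_within_itvP _ ab)[_ + _] : {within `[0 : R, 1], continuous w}; last by [].
  by apply: continuous_subspaceW wc; apply: subset_itvl; rewrite bnd_simp.
rewrite (modulus0 hw) => /cvgr0_norm_le /(_ _ e0) [d /= d0 hd].
exists d => // t; rewrite le_eqVlt => /predU1P[<- _|t0 td].
  by rewrite (modulus0 hw) ltW.
apply: le_trans (ler_norm _) _; apply: hd => //=.
by rewrite sub0r normrN gtr0_norm.
Qed.

(** By the parallelogram law the squares of the two norms have mean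
    [`|u| ^+ 2 + `|v| ^+ 2], and [phi w] is concave as a function of the square. *)
Lemma phi_norm_sum u v :
  phi w `|v - u| + phi w `|v + u| <= 2 * phi w (Num.sqrt (`|u| ^+ 2 + `|v| ^+ 2)).
Proof.
set s := Num.sqrt _.
have s2 : s ^+ 2 = `|u| ^+ 2 + `|v| ^+ 2 by rewrite sqr_sqrtr// addr_ge0// sqr_ge0.
have : 0 <= s by exact: sqrtr_ge0.
rewrite le_eqVlt => /predU1P[s0|s0].
  move: s2; rewrite -s0 expr0n /= => /esym/eqP; rewrite paddr_eq0 ?sqr_ge0//.
  rewrite !sqrf_eq0 !normr_eq0 => /andP[/eqP-> /eqP->].
  by rewrite subr0 addr0 normr0 phi0 addr0 mulr0.
have := phi_tangent hw s0 (normr_ge0 (v - u)).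
have := phi_tangent hw s0 (normr_ge0 (v + u)).
set c := w s / (2 * s); have := parallelogram hdot v u; rewrite s2 => E h1 h2.
have : phi w `|v - u| + phi w `|v + u| <= 2 * phi w s +
    c * (`|v + u| ^+ 2 + `|v - u| ^+ 2 - 2 * (`|u| ^+ 2 + `|v| ^+ 2)) by lra.
by rewrite E (_ : 2 * _ - _ = 0) ?mulr0 ?addr0//; ring.
Qed.

(** If [k] is short, [phi_tangent] at the norm of [x] gives the linear term and
    an error [w `|x| * `|k| ^+ 2 / (2 * `|x|)], which is largest when
    [`|x| = `|k| / 2]. If [k] is long, the tangent is taken at [`|k| - `|x|]: this
    reduces to [k] opposite to [x], which is [phi_reflect]. *)
Lemma phi_norm_supergradient K x k : doubling_const w K ->
  phi w `|x + k| <= phi w `|x| + w `|x| / `|x| * dot x k + K * phi w `|k|.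
Proof.
move=> hK; set r := `|x|; set p := `|k|.
have r0 : 0 <= r by exact: normr_ge0.
have p0 : 0 <= p by exact: normr_ge0.
have E := norm_sqD hdot x k; rewrite -/r -/p in E.
have [rp|pr] := leP (2 * r) p.
- have := phi_reflect hw hK r0 rp.
  have hd : 0 <= r * p + dot x k.
    by have := dot_norm_le hdot x k; rewrite -/r -/p ler_norml => /andP[? ?]; lra.
  suff : phi w `|x + k| <= phi w (p - r) + w r / r * (r * p + dot x k).
    have [r00|rn0] := eqVneq r 0.
      by rewrite r00 invr0 !mulr0 !mul0r; rewrite (modulus0 hw) mul0r; lra.
    rewrite mulrDr mulrA divfK//; lra.
  have [r00|rn0] := eqVneq r 0.
    have -> : x = 0 by apply/eqP; rewrite -normr_eq0 -/r r00.
    by rewrite add0r r00 subr0 invr0 mulr0 !mul0r addr0 -/p.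
  have rp0 : 0 < r by rewrite lt_def rn0.
  have s0 : 0 < p - r by lra.
  apply: le_trans (phi_tangent hw s0 (normr_ge0 _)) _.
  rewrite E lerD2l.
  rewrite (_ : r ^+ 2 + p ^+ 2 + 2 * dot x k - (p - r) ^+ 2 = 2 * (r * p + dot x k)); last by ring.
  rewrite (_ : w (p - r) / (2 * (p - r)) * (2 * (r * p + dot x k)) =
    w (p - r) / (p - r) * (r * p + dot x k)); last by field; rewrite gt_eqF.
  apply: ler_wpM2r => //.
  rewrite ler_pdivrMr// mulrAC ler_pdivlMr// mulrC [w r * _]mulrC.
  apply: modulus_ratio => //; lra.
- have rp0 : 0 < r by lra.
  apply: le_trans (phi_tangent hw rp0 (normr_ge0 _)) _.
  have -> : w `|x| / (2 * `|x|) * (`|x + k| ^+ 2 - `|x| ^+ 2) =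
      w r / r * dot x k + w r * p ^+ 2 / (2 * r).
    by rewrite E -/r; field; rewrite gt_eqF.
  rewrite addrA lerD2l; apply: le_trans (modulus_half_le_phi hw hK p0).
  rewrite ler_pdivrMr; last by lra.
  have [->|pn0] := eqVneq p 0; first by rewrite expr0n /= mulr0 !mul0r.
  have pp0 : 0 < p by rewrite lt_def pn0.
  have h : p / 2 * w r <= r * w (p / 2) by apply: modulus_ratio => //; lra.
  have := ler_wpM2l p0 h; lra.
Qed.

Definition taylor_bound B (F : X -> R) (V : X -> X) :=
  forall x y, `|F x - F y - dot (V y) (x - y)| <= B * phi w `|x - y|.

(** [s] is the half-length of the segment on which [gradient_le] tests two Taylor
    expansions centred at distance [d]; a good [s] balances the error
    [phi w (Num.sqrt (d ^+ 2 / 4 + s ^+ 2))] against the gain of a factor [s]. *)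
Definition gradient_const c := forall d, 0 < d -> exists2 s : R, 0 < s &
  2 * phi w (Num.sqrt (d ^+ 2 / 4 + s ^+ 2)) <= c * s * w d.

(** With [m] the midpoint of [x] and [y], the values of [F] at [m + v] and [m - v]
    are each expanded at [x] and at [y]. In the combination of the four
    expansions all terms cancel but [2 * dot (V x - V y) v] and four errors, at
    distances [`|v - u|] and [`|v + u|] with [u = (x - y) / 2]. The best direction
    of [v] is that of [V x - V y]. *)
Lemma gradient_le B c F V : 0 <= B -> gradient_const c -> taylor_bound B F V ->
  forall x y, `|V x - V y| <= B * c * w `|x - y|.
Proof.
move=> B0 hc hF x y; have [->|xy] := eqVneq x y.
  by rewrite !subrr !normr0 (modulus0 hw) mulr0.
have d0 : 0 < `|x - y| by rewrite normr_gt0 subr_eq0.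
have [s s0 hs] := hc _ d0.
set D := V x - V y.
have [DE|Dn0] := eqVneq D 0.
  rewrite DE normr0 -mulrA mulr_ge0// -(pmulr_lge0 _ s0) mulrAC.
  by apply: le_trans hs; rewrite mulr_ge0// phi_ge0// sqrtr_ge0.
have D0 : 0 < `|D| by rewrite normr_gt0.
pose v := (s / `|D|) *: D; pose u := 2^-1 *: (x - y); pose m := 2^-1 *: (x + y).
have nv : `|v| = s.
  by rewrite normrZ normf_div normr_id (gtr0_norm s0) divfK// gt_eqF.
have nu : `|u| ^+ 2 = `|x - y| ^+ 2 / 4.
  by rewrite normrZ exprMn ger0_norm ?invr_ge0//; field.
have half2 (a : X) : 2^-1 *: a + 2^-1 *: a = a.
  by rewrite -scalerDl (_ : 2^-1 + 2^-1 = 1) ?scale1r//; field.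
have xE : x = m + u by rewrite -scalerDr addrACA subrr addr0 scalerDr half2.
have yE : y = m - u.
  by rewrite -scalerBr opprB [x + y]addrC addrACA subrr addr0 scalerDr half2.
have h : dot D v <= B * (phi w `|v - u| + phi w `|v + u|).
  have := hF (m + v) x; have := hF (m + v) y; have := hF (m - v) x; have := hF (m - v) y.
  have shift (a b e : X) : a + b - (a + e) = b - e by rewrite opprD addrACA subrr add0r.
  have -> : m - v - y = - (v - u) by rewrite {1}yE shift -opprD.
  have -> : m - v - x = - (v + u) by rewrite {1}xE shift -opprD.
  have -> : m + v - y = v + u by rewrite {1}yE shift opprK.
  have -> : m + v - x = v - u by rewrite {1}xE shift.
  rewrite !normrN !ler_norml => /andP[a1 a2] /andP[b1 b2] /andP[c1 c2] /andP[e1 e2].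
  rewrite /D !linearNr !dotBl !dotBr !dotDr in a1 a2 b1 b2 c1 c2 e1 e2 *; lra.
have vE : dot D v = s * `|D|.
  by rewrite dotZr -hdot expr2 mulrA divfK// gt_eqF.
have := phi_norm_sum u v; rewrite nu nv => h3.
rewrite -(ler_pM2l s0) -vE; apply: le_trans h _.
have := ler_wpM2l B0 (le_trans h3 hs); lra.
Qed.

(** A copy of [dot v] that carries a structure of linear map for the scaling
    [*:%R], as differentials require; that of [dot v] is for another scaling. *)
Definition dot_left v : X -> R := dot v.

Lemma dot_left_is_linear v : linear (dot_left v).
Proof. by move=> a x y; rewrite /dot_left dotDr dotZr. Qed.

HB.instance Definition _ v :=
  GRing.isLinear.Build R X R *:%R (dot_left v) (dot_left_is_linear v).

Lemma dot_left_continuous v : continuous (dot_left v).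
Proof.
apply: bounded_linear_continuous; apply/linear_boundedP.
near=> r => x; apply: le_trans (dot_norm_le hdot v x) _.
by rewrite ler_wpM2r//; near: r; apply: nbhs_pinfty_ge; exact: num_real.
Unshelve. all: by end_near. Qed.

(** [phi w t <= t * w t] and [w] tends to 0 at 0, so the error is [o(`|k|)]. *)
Lemma differentiable_of_taylor B (F : X -> R) z v : 0 <= B ->
  (forall k, `|F (z + k) - F z - dot v k| <= B * phi w `|k|) ->
  differentiable F z /\ grad dot F z = v.
Proof.
move=> B0 hF.
have hlo : F \o shift z = cst (F z) + dot_left v +o_ (0 : X) id.
  apply/eqaddoP => e e0.
  have B1 : 0 < B + 1 by lra.
  have [d d0 hd] := modulus_small (divr_gt0 e0 B1).
  near=> k.
  have kd : `|k| < d.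
    by near: k; apply/nbhs_norm0P; exists d.
  rewrite !fctE /= [k + z]addrC opprD addrA.
  apply: le_trans (hF k) _; apply: le_trans (ler_wpM2l B0 (phi_le_mul hw (normr_ge0 k))) _.
  have := hd _ (normr_ge0 k) kd; rewrite ler_pdivlMr// => h.
  rewrite mulrCA mulrC; apply: ler_wpM2r => //.
  apply: le_trans h; rewrite mulrC; apply: ler_wpM2l; last by lra.
  exact: modulus_ge0.
have dF : 'd F z = dot_left v :> (X -> R) by apply: diff_unique hlo; exact: dot_left_continuous.
split.
  by apply/diff_locallyP; rewrite dF; split => //; exact: dot_left_continuous.
rewrite /grad; set S := [set _ | _].
have Sv : S v by move=> h; rewrite dF.
have := getPex (ex_intro _ v Sv) => Sg.
by apply: (dot_inj hdot) => h; rewrite -Sg dF.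
Unshelve. all: by end_near. Qed.

Lemma gradE (F : X -> R) z : differentiable F z ->
  forall h, 'd F z h = dot (grad dot F z) h.
Proof.
move=> dF; rewrite /grad; apply: (@getPex _ [set v | forall h, 'd F z h = dot v h]).
have dc : continuous ('d F z) by exact: diff_continuous.
have /linear_boundedP bd := (linear_bounded_continuous ('d F z)).2 dc.
have [r [r0 hr]] := filter_ex (filterI (nbhs_pinfty_gt (num_real 0)) bd).
have [||v hv] := riesz hdot _ _ hr; first exact: linearD.
  by move=> a u; rewrite linearZ.
by exists v => h.
Qed.

(** Along the segment from [y] to [x], the derivative of the remainder is at most
    that of [t |-> M * phi w (t * `|x - y|)], by Cauchy-Schwarz. *)
Lemma taylor_of_gradient_le M (F : X -> R) : (forall x, differentiable F x) ->
  (forall x y, `|grad dot F x - grad dot F y| <= M * w `|x - y|) ->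
  taylor_bound M F (grad dot F).
Proof.
move=> dF hM x y; have [->|xy] := eqVneq x y.
  by rewrite !subrr linear0r subr0 !normr0 phi0 mulr0.
set k := x - y; have k0 : 0 < `|k| by rewrite normr_gt0 subr_eq0.
have hF (t : R) : is_derive t 1 (fun t => F (y + t *: k)) (dot (grad dot F (y + t *: k)) k).
  set a := y + t *: k.
  have Eq : (fun h : R => h^-1 *:
        (((fun t => F (y + t *: k)) \o shift t) (h *: 1) - F (y + t *: k)))
      = (fun h : R => h^-1 *: ((F \o shift a) (h *: k) - F a)).
    apply/funext => h /=; congr (_ *: (F _ - _)).
    by rewrite [h *: 1]mulr1 scalerDl addrCA.
  split; first by rewrite /derivable Eq; exact: diff_derivable.
  by rewrite /derive Eq -[LHS]/('D_k F a) deriveE// gradE.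
have hl (c t : R) : is_derive t 1 (fun t : R => t * c) c.
  by under eq_fun do rewrite mulrC; exact: mull_is_derive.
suff up e : `|e| = 1 -> e * (F x - F y - dot (grad dot F y) k) <= M * phi w `|k|.
  rewrite ler_norml lerNl; apply/andP; split.
    by rewrite -mulN1r; apply: up; rewrite normrN1.
  by rewrite -[X in X <= _]mul1r; apply: up; rewrite normr1.
move=> e1.
have hder (t : R) : is_derive t 1
    (fun t => e * (F (y + t *: k) - t * dot (grad dot F y) k))
    (e * (dot (grad dot F (y + t *: k)) k - dot (grad dot F y) k)).
  by apply: (@is_deriveZ R R R _ e); apply: is_deriveB.
have := @ler_sub_of_derive R
  (fun t => e * (F (y + t *: k) - t * dot (grad dot F y) k))
  (fun t => M * phi w (0 + `|k| * t)) _
  (fun t => M * (`|k| * w (0 + `|k| * t))) 0 1 ler01 (fun t _ => hder t).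
rewrite scale0r scale1r !mulr0 !addr0 !mul1r mul0r subr0 phi0 mulr0 subr0 mulr1 add0r.
rewrite (_ : y + k = x); last by rewrite /k addrC subrK.
rewrite -mulrBr (_ : F x - dot (grad dot F y) k - F y =
  F x - F y - dot (grad dot F y) k); last by ring.
apply.
- move=> t /andP[t0 _]; apply: (@is_deriveZ R R R _ M).
  by apply: phi_affine_is_derive; rewrite // add0r mulr_gt0.
- move=> t /andP[t0 _]; rewrite -dotBl add0r.
  apply: le_trans (ler_norm _) _; rewrite normrM e1 mul1r.
  apply: le_trans (dot_norm_le hdot _ _) _; rewrite mulrCA mulrC ler_wpM2l//.
  by apply: le_trans (hM _ _) _; rewrite [y + _]addrC addrK normrZ gtr0_norm// [t * _]mulrC.
- by move=> t; apply: differentiable_continuous; apply/derivable1_diffP; case: (hder t).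
- by move=> t; apply: cvgM; [exact: cvg_cst|exact: phi_affine_continuous].
Qed.

End smooth.

(** * Functions that are paraconvex and paraconcave are differentiable *)
Section paraconvexity.
Context {R : realType} {X : completeNormedModType R}.
Variable dot : {dot X for idfun}.
Hypothesis hdot : induces_norm dot.
Variable w : R -> R.
Hypothesis hw : is_modulus w.
Implicit Types x y z h k u v : X.

(** For weights [l] and [1 - l], the centre of gravity of two points at distance
    [t] is at distance [(1 - l) * t] from the first and [l * t] from the second.
    The gap is the weighted mean of [phi w] at these distances, that is, the error
    of the weighted mean of two Taylor expansions at the centre. *)
Definition gap (l t : R) := l * phi w ((1 - l) * t) + (1 - l) * phi w (l * t).

(** The centre of gravity [z] of the two points and their difference [k] are the
    parameters, rather than the points themselves: this makes the invariance of
    the notion under translation immediate. *)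
Definition paraconvex (B : R) (F : X -> R) := forall z k l, 0 <= l -> l <= 1 ->
  F z <= l * F (z + (1 - l) *: k) + (1 - l) * F (z - l *: k) + B * gap l `|k|.

Definition paraconcave (B : R) (F : X -> R) := forall z k l, 0 <= l -> l <= 1 ->
  l * F (z + (1 - l) *: k) + (1 - l) * F (z - l *: k) <= F z + B * gap l `|k|.

Lemma eq0_of_le_modulus (r C c : R) : 0 <= C -> 0 <= c ->
  (forall t, 0 < t -> `|r| <= C * w (t * c)) -> r = 0.
Proof.
move=> C0 c0 h; apply/eqP; rewrite -normr_le0; apply/ler_addgt0Pl => e e0; rewrite addr0.
have C1 : 0 < C + 1 by lra.
have [d d0 hd] := modulus_small hw (divr_gt0 e0 C1).
have c1 : 0 < c + 1 by lra.
pose t := d / 2 / (c + 1).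
have t0 : 0 < t by rewrite !divr_gt0.
have tc : t * c < d.
  by rewrite /t mulrAC ltr_pdivrMr//; nra.
have := hd (t * c) (mulr_ge0 (ltW t0) c0) tc; rewrite ler_pdivlMr// => h1.
have := modulus_ge0 hw (mulr_ge0 (ltW t0) c0); have := h t t0; lra.
Qed.

Section taylor_expansion.
Variables (B : R) (F : X -> R) (z : X).
Hypothesis B0 : 0 <= B.
Hypotheses (Fvex : paraconvex B F) (Fcave : paraconcave B F).

(** [z + l *: k] is the centre of gravity of [z + k] and [z]. *)
Lemma almost_affine k l : 0 <= l -> l <= 1 ->
  `|F (z + l *: k) - F z - l * (F (z + k) - F z)| <= B * gap l `|k|.
Proof.
move=> l0 l1; have := Fvex (z + l *: k) k l0 l1; have := Fcave (z + l *: k) k l0 l1.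
rewrite addrK -addrA -scalerDl (_ : l + (1 - l) = 1) ?scale1r; last by ring.
by rewrite ler_norml => h1 h2; apply/andP; split; lra.
Qed.

Lemma gap_le l t : 0 <= l -> l <= 1 -> 0 <= t ->
  gap l t <= l * phi w t + phi w (l * t).
Proof.
move=> l0 l1 t0; rewrite /gap lerD//.
  apply: ler_wpM2l => //; apply: phi_le => //; first by rewrite mulr_ge0//; lra.
  by rewrite ler_piMl//; lra.
by rewrite ler_piMl ?phi_ge0 ?mulr_ge0//; lra.
Qed.

Let q k t := (F (z + t *: k) - F z) / t.

Lemma slope_diff k s t : 0 < s -> s <= t ->
  `|q k s - q k t| <= B * (phi w (t * `|k|) / t + `|k| * w (s * `|k|)).
Proof.
move=> s0 st; have t0 : 0 < t by exact: lt_le_trans st.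
have l0 : 0 <= s / t by rewrite divr_ge0 ?ltW.
have l1 : s / t <= 1 by rewrite ler_pdivrMr// mul1r.
have := @almost_affine (t *: k) (s / t) l0 l1.
rewrite scalerA divfK ?gt_eqF// normrZ gtr0_norm// => h.
have {h} h := le_trans h (ler_wpM2l B0 (gap_le l0 l1 (mulr_ge0 (ltW t0) (normr_ge0 k)))).
have -> : q k s - q k t = (F (z + s *: k) - F z - s / t * (F (z + t *: k) - F z)) / s.
  by rewrite /q; field; rewrite !gt_eqF.
rewrite normrM normfV (gtr0_norm s0) ler_pdivrMr//.
apply: le_trans h _; rewrite -[X in _ <= X]mulrA ler_wpM2l// [s / t * (t * _)]mulrA divfK ?gt_eqF//.
rewrite mulrDl (_ : phi w (t * `|k|) / t * s = s / t * phi w (t * `|k|)); last by ring.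
rewrite lerD2l (_ : _ * _ * s = s * `|k| * w (s * `|k|)); last by ring.
by apply: phi_le_mul; rewrite // mulr_ge0// ltW.
Qed.

(** By [slope_diff] the difference quotients [q k s] are Cauchy as [s] tends to
    [0^'+]. Letting [s] tend to 0 in [slope_diff] removes the term with [w] and
    leaves the bound at [t]. *)
Lemma slope_exists k : exists l, forall t, 0 < t ->
  `|F (z + t *: k) - F z - t * l| <= B * phi w (t * `|k|).
Proof.
have n0 := normr_ge0 k.
have qc : cauchy (q k s @[s --> 0^'+]).
  apply: cauchy_exP => e e0.
  have c0 : 0 < 2 * B * `|k| + 1 by have := mulr_ge0 B0 n0; lra.
  have [d d0 hd] := modulus_small hw (divr_gt0 (divr_gt0 e0 (ltr0n _ 2)) c0).
  pose t := d / 2 / (`|k| + 1).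
  have t0 : 0 < t by rewrite !divr_gt0//; lra.
  have tk : t * `|k| < d by rewrite /t mulrAC ltr_pdivrMr; [nra|lra].
  exists (q k t); suff : \forall s \near 0^'+, ball (q k t) e (q k s) by [].
  near=> s; rewrite -ball_normE /= distrC.
  have s0 : 0 < s by near: s; exact: nbhs_right_gt.
  have st : s <= t by near: s; exact: nbhs_right_le.
  apply: le_lt_trans (slope_diff _ s0 st) _.
  have h1 : phi w (t * `|k|) / t <= `|k| * w (t * `|k|).
    rewrite ler_pdivrMr//; apply: le_trans (phi_le_mul hw _) _; first by rewrite mulr_ge0// ltW.
    by rewrite le_eqVlt; apply/orP; left; apply/eqP; ring.
  have h2 : `|k| * w (s * `|k|) <= `|k| * w (t * `|k|).
    by rewrite ler_wpM2l//; apply: (modulus_le hw); [rewrite mulr_ge0// ltW|rewrite ler_wpM2r].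
  have := hd _ (mulr_ge0 (ltW t0) n0) tk; rewrite ler_pdivlMr// => h3.
  have := ler_wpM2l B0 (lerD h1 h2).
  have := modulus_ge0 hw (mulr_ge0 (ltW t0) n0).
  lra.
have ql : q k s @[s --> 0^'+] --> lim (q k s @[s --> 0^'+]) by exact: cauchy_cvg.
set l := lim _ in ql; exists l => t t0.
suff h : `|l - q k t| <= B * (phi w (t * `|k|) / t).
  have -> : F (z + t *: k) - F z - t * l = t * (q k t - l).
    by rewrite /q; field; rewrite gt_eqF.
  rewrite normrM (gtr0_norm t0) distrC; apply: le_trans (ler_wpM2l (ltW t0) h) _.
  by rewrite le_eqVlt; apply/orP; left; apply/eqP; field; rewrite gt_eqF.
apply/ler_addgt0Pl => e e0.
have c0 : 0 < B * `|k| + 1 by have := mulr_ge0 B0 n0; lra.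
have e20 : 0 < e / 2 by rewrite divr_gt0.
have [d d0 hd] := modulus_small hw (divr_gt0 e20 c0).
near (at_right (0 : R)) => s.
have s0 : 0 < s by near: s; exact: nbhs_right_gt.
have st : s <= t by near: s; exact: nbhs_right_le.
have sd : s <= d / 2 / (`|k| + 1).
  by near: s; apply: nbhs_right_le; rewrite !divr_gt0//; lra.
have sk : s * `|k| < d.
  have : s * (`|k| + 1) <= d / 2 by rewrite -ler_pdivlMr//; lra.
  nra.
have hl : `|l - q k s| <= e / 2.
  by near: s; move/cvgrPdist_le : ql; apply.
have := slope_diff k s0 st.
have := hd _ (mulr_ge0 (ltW s0) n0) sk; rewrite ler_pdivlMr// => h3 h4.
have := ler_distD (q k s) l (q k t).
have := modulus_ge0 hw (mulr_ge0 (ltW s0) n0).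
lra.
Unshelve. all: by end_near. Qed.

(** The limit slope [L k] in direction [k] is determined by its error bound, which
    gives positive homogeneity. Additivity is read off the midpoint
    [z + t *: (k + h)] of [z + (2 * t) *: k] and [z + (2 * t) *: h], up to an error
    [6 * B * n * w (2 * n * t)] per unit of [t], which vanishes with [t]. Local
    boundedness of [F] makes [L] bounded, hence a scalar product. *)
Lemma taylor_vector M : (forall k, `|k| <= 1 -> `|F (z + k)| <= M) ->
  exists v, forall k, `|F (z + k) - F z - dot v k| <= B * phi w `|k|.
Proof.
move=> hM; have [L hL] := choice slope_exists.
have Luniq k l : (forall t, 0 < t ->
  `|F (z + t *: k) - F z - t * l| <= B * phi w (t * `|k|)) -> L k = l.
  move=> hl; apply/eqP; rewrite -subr_eq0; apply/eqP.
  apply: (@eq0_of_le_modulus _ (2 * B * `|k|) `|k|); rewrite ?mulr_ge0// => t t0.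
  rewrite -(ler_pM2l t0).
  have -> : t * `|L k - l| = `|t * (L k - l)| by rewrite normrM gtr0_norm.
  have := phi_le_mul hw (mulr_ge0 (ltW t0) (normr_ge0 k)) => /(ler_wpM2l B0).
  have := hL k t t0; have := hl t t0.
  by rewrite !ler_norml => /andP[? ?] /andP[? ?] ?; apply/andP; split; lra.
have Lpos k s : 0 < s -> L (s *: k) = s * L k.
  move=> s0; apply: Luniq => t t0; rewrite scalerA mulrA.
  by have := hL k (t * s) (mulr_gt0 t0 s0); rewrite normrZ gtr0_norm// [t * (s * _)]mulrA.
have L0 : L 0 = 0.
  by apply: Luniq => t t0; rewrite scaler0 addr0 subrr mulr0 subr0 !normr0 mulr0 phi0 mulr0.
have LD k h : L (k + h) = L k + L h.
  apply/eqP; rewrite -subr_eq0; apply/eqP.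
  pose n := `|k| + `|h|; have n0 : 0 <= n by rewrite addr_ge0.
  apply: (@eq0_of_le_modulus _ (6 * B * n) (2 * n)); rewrite ?mulr_ge0// => t t0.
  rewrite -(ler_pM2l t0).
  have -> : t * `|L (k + h) - (L k + L h)| = `|t * (L (k + h) - (L k + L h))|.
    by rewrite normrM gtr0_norm.
  have t20 : 0 < 2 * t by lra.
  have le c : 0 <= c -> c <= 2 * n -> B * phi w (t * c) <= B * phi w (t * (2 * n)).
    move=> c0 cn; rewrite ler_wpM2l//; apply: phi_le => //; first by rewrite mulr_ge0// ltW.
    by rewrite ler_wpM2l// ltW.
  have le2 c : 0 <= c -> c <= n -> B * phi w (2 * t * c) <= B * phi w (t * (2 * n)).
    by move=> c0 cn; rewrite (_ : 2 * t * c = t * (2 * c)); [apply: le; lra|ring].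
  have nk := normr_ge0 k; have nh := normr_ge0 h.
  have := le_trans (hL (k + h) t t0) (le _ (normr_ge0 _) _).
  have := le_trans (hL k (2 * t) t20) (le2 _ nk _).
  have := le_trans (hL h (2 * t) t20) (le2 _ nh _).
  have := phi_le_mul hw (mulr_ge0 (ltW t0) (mulr_ge0 (ler0n _ 2) n0)) => /(ler_wpM2l B0).
  have half0 : 0 <= 2^-1 :> R by lra.
  have half1 : 2^-1 <= 1 :> R by lra.
  have mid1 : z + t *: (k + h) + (1 - 2^-1) *: ((2 * t) *: (k - h)) = z + (2 * t) *: k.
    rewrite scalerA (_ : (1 - 2^-1) * (2 * t) = t); last by field.
    rewrite -addrA -scalerDr addrACA subrr addr0 -[k + k]mulr2n -scaler_nat scalerA.
    by rewrite [t * _]mulrC.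
  have mid2 : z + t *: (k + h) - 2^-1 *: ((2 * t) *: (k - h)) = z + (2 * t) *: h.
    rewrite scalerA (_ : 2^-1 * (2 * t) = t); last by field.
    rewrite -addrA -scalerBr opprB [k + h]addrC addrACA subrr addr0.
    by rewrite -[h + h]mulr2n -scaler_nat scalerA [t * _]mulrC.
  have := Fvex (z + t *: (k + h)) ((2 * t) *: (k - h)) half0 half1.
  have := Fcave (z + t *: (k + h)) ((2 * t) *: (k - h)) half0 half1.
  rewrite mid1 mid2.
  have -> : gap 2^-1 `|(2 * t) *: (k - h)| = phi w (t * `|k - h|).
    rewrite normrZ gtr0_norm// /gap (_ : (1 - 2^-1 : R) = 2^-1); last by field.
    by rewrite (_ : 2^-1 * (2 * t * `|k - h|) = t * `|k - h|); field.
  have := le `|k - h| (normr_ge0 _) _.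
  have kh := ler_normD k h; have kh' := ler_normB k h.
  rewrite /n; move=> /(_ ltac:(lra)) a1 a2 a3 a4.
  move=> /(_ ltac:(lra)) a5 /(_ ltac:(lra)) a6 /(_ ltac:(lra)) a7.
  move: a5 a6 a7; rewrite !ler_norml => /andP[? ?] /andP[? ?] /andP[? ?].
  by apply/andP; split; lra.
have LN k : L (- k) = - L k.
  by apply/eqP; rewrite -subr_eq0 opprK -LD addNr L0.
have LZ (a : R) k : L (a *: k) = a * L k.
  have [a0|a0|->] := ltgtP a 0; last by rewrite scale0r mul0r.
    by rewrite -[a]opprK scaleNr LN mulNr Lpos// oppr_gt0.
  exact: Lpos.
have [|v hv] := @riesz _ _ _ hdot L (M + `|F z| + B * phi w 1) LD LZ.
  move=> k; have [->|k0] := eqVneq k 0; first by rewrite L0 !normr0 mulr0.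
  have nk : 0 < `|k| by rewrite normr_gt0.
  have -> : k = `|k| *: (`|k|^-1 *: k) by rewrite scalerA divff ?scale1r// gt_eqF.
  set h := `|k|^-1 *: k.
  have nh : `|h| = 1 by rewrite normrZ normfV normr_id mulVf// gt_eqF.
  rewrite LZ normrM normrZ nh mulr1 mulrC ler_wpM2r//.
  have := hL h 1 ltr01; rewrite scale1r !mul1r nh => h1.
  have := hM h; rewrite nh lexx => /(_ isT) h2.
  move: h1 h2; have := ler_norm (F z); have := ler_norm (- F z); rewrite normrN.
  rewrite !ler_norml => ? ? /andP[? ?] /andP[? ?].
  by apply/andP; split; lra.
by exists v => k; have := hL k 1 ltr01; rewrite scale1r !mul1r hv.
Qed.

End taylor_expansion.
End paraconvexity.

(** * The paraconvex envelope of a jet *)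
Section extension.
Context {R : realType} {X : completeNormedModType R}.
Variable dot : {dot X for idfun}.
Hypothesis hdot : induces_norm dot.
Variable w : R -> R.
Hypothesis hw : is_modulus w.
Implicit Types x y z k u v : X.
Variable K : R.
Hypothesis hK : doubling_const w K.

(** The linear terms of the two expansions at [x] cancel in the weighted mean. *)
Lemma phi_norm_paraconcave x k l : 0 <= l -> l <= 1 ->
  l * phi w `|x + (1 - l) *: k| + (1 - l) * phi w `|x - l *: k| <=
  phi w `|x| + K * gap w l `|k|.
Proof.
move=> l0 l1; have l1' : 0 <= 1 - l by lra.
have := phi_norm_supergradient hdot hw x ((1 - l) *: k) hK => /(ler_wpM2l l0).
have := phi_norm_supergradient hdot hw x (- (l *: k)) hK => /(ler_wpM2l l1').
set c := w _ / _; rewrite dotNr normrN !dotZr !normrZ !ger0_norm// /gap; lra.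
Qed.

Variables (a : R) (E : set X) (f : X -> R) (G : X -> X) (e0 : X).
Hypotheses (a0 : 0 <= a) (Ee0 : E e0).
Hypothesis hA : forall x y z, E y -> E z ->
  `|f y + dot (G y) (x - y) - f z - dot (G z) (x - z)| <=
  a * (phi w `|x - y| + phi w `|x - z|).

Definition jet_upper e x := f e + dot (G e) (x - e) + a * phi w `|x - e|.
Definition jet_lower e x := f e + dot (G e) (x - e) - a * phi w `|x - e|.

Lemma doubling_const_ge0 : 0 <= K.
Proof.
have := hK ler01; have : 0 < w (1 / 2) by apply: modulus_gt0.
by move=> ? ?; rewrite -(pmulr_lge0 _ (modulus_gt0 hw ltr01)); lra.
Qed.

Lemma jet_lower_paraconvex e : paraconvex w (a * K) (jet_lower e).
Proof.
move=> z k l l0 l1; rewrite /jet_lower [z + _ - e]addrAC [z - _ - e]addrAC.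
rewrite (dotDr _ _ (z - e)) (dotBr _ _ (z - e)) !dotZr.
have := ler_wpM2l a0 (phi_norm_paraconcave (z - e) k l0 l1); lra.
Qed.

Lemma jet_upper_paraconcave e : paraconcave w (a * K) (jet_upper e).
Proof.
move=> z k l l0 l1; rewrite /jet_upper [z + _ - e]addrAC [z - _ - e]addrAC.
rewrite (dotDr _ _ (z - e)) (dotBr _ _ (z - e)) !dotZr.
have := ler_wpM2l a0 (phi_norm_paraconcave (z - e) k l0 l1); lra.
Qed.

(** Membership asks to lie below every upper function instead of below their
    infimum, which would be a further object to handle. *)
Definition minorants : set (X -> R) :=
  [set h | paraconvex w (a * K) h /\ forall e, E e -> forall x, h x <= jet_upper e x].

Definition envelope x := sup [set h x | h in minorants].

Lemma jet_lower_minorant e : E e -> minorants (jet_lower e).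
Proof.
move=> Ee; split; first exact: jet_lower_paraconvex.
move=> e' Ee' x; have := hA x Ee Ee'; rewrite ler_norml => /andP[_].
by rewrite /jet_lower /jet_upper; lra.
Qed.

Lemma le_envelope h x : minorants h -> h x <= envelope x.
Proof.
move=> mh; apply: ub_le_sup; last by exists h.
by exists (jet_upper e0 x) => _ [h' [_ mh'] <-]; exact: mh'.
Qed.

Lemma envelope_le x (b : R) : (forall h, minorants h -> h x <= b) -> envelope x <= b.
Proof.
move=> hb; apply: ge_sup; last by move=> _ [h mh <-]; exact: hb.
by exists (jet_lower e0 x), (jet_lower e0) => //; exact: jet_lower_minorant.
Qed.

Lemma envelope_le_upper e x : E e -> envelope x <= jet_upper e x.
Proof. by move=> Ee; apply: envelope_le => h [_]; apply. Qed.

Lemma envelope_paraconvex : paraconvex w (a * K) envelope.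
Proof.
move=> z k l l0 l1; apply: envelope_le => h mh.
apply: le_trans (mh.1 z k l l0 l1) _.
by rewrite lerD2r lerD// ler_wpM2l ?le_envelope//; lra.
Qed.

(** For fixed [k] and [l], the function [u] of the proof is a mean of two
    translates of the envelope minus a constant, hence is paraconvex; and
    paraconcavity of the upper functions puts [u] below them. So [u] is a minorant,
    and its value at [z] is at most that of the envelope. *)
Lemma envelope_paraconcave : paraconcave w (a * K) envelope.
Proof.
move=> z k l l0 l1; have l1' : 0 <= 1 - l by lra.
pose u y := l * envelope (y + (1 - l) *: k) + (1 - l) * envelope (y - l *: k)
            - a * K * gap w l `|k|.
suff /(@le_envelope _ z) : minorants u by rewrite /u; lra.
split => [y k' l' l'0 l'1|e Ee y].
  have := envelope_paraconvex (y + (1 - l) *: k) k' l'0 l'1.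
  have := envelope_paraconvex (y - l *: k) k' l'0 l'1.
  move=> /(ler_wpM2l l1') h1 /(ler_wpM2l l0) h2.
  rewrite ![y - l *: k + _]addrAC in h1; rewrite ![y + (1 - l) *: k + _]addrAC in h2.
  by rewrite /u; lra.
have := jet_upper_paraconcave e y k l0 l1.
have := ler_wpM2l l0 (envelope_le_upper (y + (1 - l) *: k) Ee).
have := ler_wpM2l l1' (envelope_le_upper (y - l *: k) Ee).
by rewrite /u; lra.
Qed.

Lemma envelope_locally_bounded z :
  exists M, forall k, `|k| <= 1 -> `|envelope (z + k)| <= M.
Proof.
pose r := `|z - e0| + 1.
exists (`|f e0| + `|G e0| * r + a * phi w r) => k k1.
have kr : `|z + k - e0| <= r.
  by rewrite addrAC; apply: le_trans (ler_normD _ _) _; rewrite lerD2l.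
have := envelope_le_upper (z + k) Ee0.
have := le_envelope (z + k) (jet_lower_minorant Ee0).
rewrite /jet_lower /jet_upper.
have := ler_wpM2l a0 (phi_le hw (normr_ge0 _) kr).
have := dot_norm_le hdot (G e0) (z + k - e0).
have := ler_wpM2l (normr_ge0 (G e0)) kr.
have := ler_norm (f e0); have := ler_norm (- f e0); rewrite normrN.
rewrite !ler_norml => ? ? ? /andP[? ?] ? ? ?; apply/andP; split; lra.
Qed.

(** On [E] the lower and the upper function at [e] agree to first order at [e], and
    so does the envelope that lies between them. *)
Lemma jet_extension : exists F : X -> R,
  [/\ forall x, differentiable F x, taylor_bound dot w (a * K) F (grad dot F)
    & jet_on dot E F f G].
Proof.
have B0 : 0 <= a * K by rewrite mulr_ge0// doubling_const_ge0.
have hz z : differentiable envelope z /\ forall k,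
    `|envelope (z + k) - envelope z - dot (grad dot envelope z) k| <= a * K * phi w `|k|.
  have [M hM] := envelope_locally_bounded z.
  have [v hv] := taylor_vector hdot hw B0 envelope_paraconvex envelope_paraconcave hM.
  by have [dz ->] := differentiable_of_taylor hdot hw B0 hv.
exists envelope; split.
- by move=> x; case: (hz x).
- move=> x y; have := (hz y).2 (x - y).
  by rewrite [y + _]addrC subrK.
- move=> e Ee.
  have fe : envelope e = f e.
    have := envelope_le_upper e Ee; have := le_envelope e (jet_lower_minorant Ee).
    rewrite /jet_lower /jet_upper subrr linear0r normr0 phi0 mulr0 subr0 !addr0.
    by move=> h1 h2; apply/eqP; rewrite eq_le h1 h2.
  split => //.
  have [] // := @differentiable_of_taylor _ _ _ hdot _ hw a envelope e (G e) a0.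
  move=> k; rewrite fe.
  have := envelope_le_upper (e + k) Ee; have := le_envelope (e + k) (jet_lower_minorant Ee).
  rewrite /jet_lower /jet_upper [e + k]addrC addrK ler_norml => h1 h2.
  by apply/andP; split; lra.
Qed.

End extension.

(** * Comparison of the two seminorms *)
Section corollary.
Context {R : realType} {X : completeNormedModType R}.
Variable dot : {dot X for idfun}.
Hypothesis hdot : induces_norm dot.
Variable w : R -> R.
Hypothesis hw : is_modulus w.
Implicit Types (E : set X) (f H : X -> R) (G : X -> X).

Lemma sup0_ge0 (S : set (\bar R)) : (0 <= sup0 S)%E.
Proof. by apply: ereal_sup_ubound; left. Qed.

Lemma sup0_ubound (S : set (\bar R)) r : S r -> (r <= sup0 S)%E.
Proof. by move=> Sr; apply: ereal_sup_ubound; right. Qed.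

Lemma sup0_le (S : set (\bar R)) b : (0 <= b)%E -> (forall r, S r -> (r <= b)%E) ->
  (sup0 S <= b)%E.
Proof. by move=> b0 hb; apply: ge_ereal_sup => r [->|/hb]. Qed.

Lemma Mw_le H M : 0 <= M ->
  (forall x y, `|grad dot H x - grad dot H y| <= M * w `|x - y|) ->
  (Mw dot w H <= M%:E)%E.
Proof.
move=> M0 hM; apply: sup0_le; first by rewrite lee_fin.
move=> _ [x [y [/eqP xy ->]]]; rewrite lee_fin ler_pdivrMr//.
by apply: modulus_gt0; rewrite // normr_gt0 subr_eq0.
Qed.

Lemma gradient_le_Mw H M x y : Mw dot w H = M%:E ->
  `|grad dot H x - grad dot H y| <= M * w `|x - y|.
Proof.
move=> HM; have [->|xy] := eqVneq x y.
  by rewrite !subrr !normr0 (modulus0 hw) mulr0.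
rewrite -ler_pdivrMr; last by apply: modulus_gt0; rewrite // normr_gt0 subr_eq0.
by rewrite -lee_fin -HM; apply: sup0_ubound; exists x, y; split => //; exact/eqP.
Qed.

Lemma Mw_fin H : C1w dot w H -> Mw dot w H \is a fin_num.
Proof.
move=> [_ [C C0 hC]]; rewrite ge0_fin_numE; last exact: sup0_ge0.
by apply: le_lt_trans (Mw_le (ltW C0) hC) _; rewrite ltry.
Qed.

Lemma phi_sum_gt0 (s t : R) : 0 <= s -> 0 <= t -> 0 < s + t -> 0 < phi w s + phi w t.
Proof.
move=> s0 t0; have [->|sn0] := eqVneq s 0.
  by rewrite add0r phi0 add0r; exact: phi_gt0.
move=> _; rewrite ltr_wpDr ?phi_ge0// phi_gt0// lt_def sn0//.
Qed.

Lemma abs_triangle (h b db c dc s t M : R) :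
  `|h - b - db| <= M * s -> `|h - c - dc| <= M * t ->
  `|b + db - c - dc| <= M * (s + t).
Proof.
by rewrite !ler_norml => /andP[? ?] /andP[? ?]; apply/andP; split; lra.
Qed.

Lemma Ajet_le_Mw E f G H : C1w dot w H -> jet_on dot E H f G ->
  (Ajet dot w E f G <= Mw dot w H)%E.
Proof.
move=> CH jH; have /fineK := Mw_fin CH; set M := fine _ => HM.
have M0 : 0 <= M by rewrite -lee_fin HM sup0_ge0.
rewrite -HM; apply: sup0_le; first by rewrite lee_fin.
move=> _ [x [y [z [Ey Ez h ->]]]]; rewrite lee_fin ler_pdivrMr ?phi_sum_gt0//.
have T := taylor_of_gradient_le hdot hw CH.1 (fun x y => gradient_le_Mw x y (esym HM)).
have [<- <-] := jH _ Ey; have [<- <-] := jH _ Ez.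
exact: abs_triangle (T x y) (T x z).
Qed.

(** The case [x = y = z], which [Ajet] leaves out, is trivial. *)
Lemma Ajet_bound E f G (a : R) : Ajet dot w E f G = a%:E -> forall x y z, E y -> E z ->
  `|f y + dot (G y) (x - y) - f z - dot (G z) (x - z)| <=
  a * (phi w `|x - y| + phi w `|x - z|).
Proof.
move=> HA x y z Ey Ez.
have := addr_ge0 (normr_ge0 (x - y)) (normr_ge0 (x - z)).
rewrite le_eqVlt => /predU1P[/esym/eqP|h].
  rewrite paddr_eq0// !normr_eq0 !subr_eq0 => /andP[/eqP <- /eqP <-].
  by rewrite subrr linear0r addr0 subrr subr0 !normr0 phi0 addr0 mulr0.
rewrite -ler_pdivrMr ?phi_sum_gt0// -lee_fin -HA; apply: sup0_ubound.
by exists x, y, z.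
Qed.

Lemma extension_of_consts E f G K c : E !=set0 ->
  doubling_const w K -> gradient_const w c -> (Ajet dot w E f G < +oo)%E ->
  exists F, [/\ C1w dot w F, jet_on dot E F f G &
    (Mw dot w F <= (K * c)%:E * Ajet dot w E f G)%E].
Proof.
move=> [e0 Ee0] hK hc Afin.
have Anum : Ajet dot w E f G \is a fin_num by rewrite ge0_fin_numE ?sup0_ge0.
set a := fine (Ajet dot w E f G); have aE : Ajet dot w E f G = a%:E by rewrite fineK.
have a0 : 0 <= a by rewrite -lee_fin -aE sup0_ge0.
have [F [dF tF jF]] := jet_extension hdot hw hK a0 Ee0 (Ajet_bound aE).
have K0 := doubling_const_ge0 hw hK.
have c0 : 0 <= c.
  have [s s0 hs] := hc 1 ltr01.
  rewrite -(pmulr_lge0 _ (modulus_gt0 hw ltr01)) -(pmulr_lge0 _ s0) mulrAC.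
  by apply: le_trans hs; rewrite mulr_ge0// phi_ge0// sqrtr_ge0.
have M0 : 0 <= a * K * c by rewrite !mulr_ge0.
have gF := gradient_le hdot hw (mulr_ge0 a0 K0) hc tF.
exists F; split => //.
  split => //; exists (a * K * c + 1); first by lra.
  move=> x y; apply: le_trans (gF x y) _.
  by rewrite ler_wpM2r ?modulus_ge0//; lra.
rewrite aE -EFinM (_ : K * c * a = a * K * c); last by ring.
exact: Mw_le.
Qed.

Lemma Ajet_le_jet_norm E f G : (Ajet dot w E f G <= jet_norm dot w E f G)%E.
Proof. by apply: le_ereal_inf_tmp => _ [H [CH jH] <-]; exact: Ajet_le_Mw. Qed.

Lemma jet_norm_le E f G K c : E !=set0 ->
  doubling_const w K -> gradient_const w c -> (Ajet dot w E f G < +oo)%E ->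
  (jet_norm dot w E f G <= (K * c)%:E * Ajet dot w E f G)%E.
Proof.
move=> hE hK hc Afin; have [F [CF jF]] := extension_of_consts hE hK hc Afin.
by apply: le_trans; apply: ereal_inf_lbound; exists F.
Qed.

Lemma doubling_const2 : doubling_const w 2.
Proof. by move=> t t0; rewrite ler_pM2l//; apply: (modulus_le hw); lra. Qed.

(** The step [sqrt 15 / 2 * d] turns the radius [sqrt (d ^+ 2 / 4 + s ^+ 2)] into
    [2 * d], where [phi_double] applies. *)
Lemma gradient_const_general : gradient_const w (8 / Num.sqrt 15).
Proof.
move=> d d0; have q0 : 0 < Num.sqrt 15 :> R by rewrite sqrtr_gt0.
exists (Num.sqrt 15 / 2 * d); first by rewrite !mulr_gt0.
have -> : d ^+ 2 / 4 + (Num.sqrt 15 / 2 * d) ^+ 2 = (2 * d) ^+ 2.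
  by rewrite !exprMn exprVn sqr_sqrtr//; field.
rewrite sqrtr_sqr ger0_norm; last by lra.
have -> : 8 / Num.sqrt 15 * (Num.sqrt 15 / 2 * d) * w d = 2 * (2 * d * w d).
  by field; rewrite gt_eqF.
by rewrite ler_pM2l//; apply: phi_double => //; exact: ltW.
Qed.

Section power.
Variable p : R.
Hypotheses (p0 : 0 < p) (p1 : p <= 1) (wE : forall t : R, 0 <= t -> w t = t `^ p).

Lemma powR_half : 2^-1 `^ p = (2 `^ p)^-1 :> R.
Proof. by rewrite -[in LHS]powR_inv1// -powRrM mulN1r powRN. Qed.

Lemma doubling_const_power : doubling_const w (2 / 2 `^ p).
Proof.
move=> t t0; rewrite !wE// ?divr_ge0// powRM ?invr_ge0//.
by rewrite powR_half le_eqVlt; apply/orP; left; apply/eqP; ring.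
Qed.

(** [x `^ (1 + p)] is not continuous at 0 from the left (it is 1 there), so the
    comparison of derivatives starts at some [d > 0] with [phi w d <= e]. *)
Lemma phi_power_le s : 0 < s -> phi w s <= s `^ (1 + p) / (1 + p).
Proof.
move=> s0; have q0 : 0 < 1 + p by rewrite addr_gt0.
apply/ler_addgt0Pl => e e0.
have ws := modulus_ge0 hw (ltW s0).
pose d := Num.min s (e / (w s + 1)).
have d0 : 0 < d by rewrite /d lt_min s0 divr_gt0//; lra.
have ds : d <= s by rewrite /d ge_min lexx.
have de : d * (w s + 1) <= e.
  by rewrite -ler_pdivlMr; [rewrite /d ge_min lexx orbT|lra].
have der (x : R) : 0 < x -> is_derive x 1 (fun x => (1 + p)^-1 * x `^ (1 + p)) (w x).
  move=> x0; have h := @is_deriveZ R R R _ (1 + p)^-1 x 1 _ (is_derive1_powR (1 + p) x0).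
  suff -> : w x = (1 + p)^-1 *: ((1 + p) * x `^ (1 + p - 1)) by exact: h.
  rewrite [_ *: _]mulrA mulVf ?mul1r ?gt_eqF// wE ?(ltW x0)//.
  by congr (_ `^ _); ring.
have mvt := @ler_sub_of_derive_within R (phi w) (fun x => (1 + p)^-1 * x `^ (1 + p)) w w d s ds.
have hd : phi w d <= e.
  apply: le_trans (phi_le_mul hw (ltW d0)) _; apply: le_trans de.
  by rewrite ler_pM2l//; have := modulus_le hw (ltW d0) ds; lra.
have pd : 0 <= (1 + p)^-1 * d `^ (1 + p) by rewrite mulr_ge0 ?powR_ge0// invr_ge0 ltW.
suff H : phi w s - phi w d <= (1 + p)^-1 * s `^ (1 + p) - (1 + p)^-1 * d `^ (1 + p).
  by rewrite [_ / (1 + p)]mulrC; lra.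
apply: mvt => //.
- by move=> x /andP[dx _]; apply: phi_is_derive => //; exact: lt_trans dx.
- by move=> x /andP[dx _]; apply: der; exact: lt_trans dx.
- by apply: continuous_subspaceT; exact: phi_continuous.
- apply: derivable_within_continuous => x; rewrite in_itv/= => /andP[dx _].
  by have [] := der x (lt_le_trans d0 dx).
Qed.

(** The step [d / (2 * sqrt p)] minimises
    [s |-> (d ^+ 2 / 4 + s ^+ 2) `^ ((1 + p) / 2) / s]. *)
Lemma gradient_const_power :
  gradient_const w (2 / 2 `^ p / Num.sqrt (1 + p) * (1 + p^-1) `^ (p / 2)).
Proof.
move=> d d0; have q0 : 0 < 1 + p by rewrite addr_gt0.
have Q0 : 0 < 1 + p^-1 by rewrite addr_gt0 ?invr_gt0.
have sp : 0 < Num.sqrt p by rewrite sqrtr_gt0.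
exists (d / 2 / Num.sqrt p); first by rewrite !divr_gt0.
have -> : d ^+ 2 / 4 + (d / 2 / Num.sqrt p) ^+ 2 = (d / 2) ^+ 2 * (1 + p^-1).
  by rewrite !exprMn !exprVn sqr_sqrtr ?(ltW p0)//; field; rewrite gt_eqF.
rewrite sqrtrM ?sqr_ge0// sqrtr_sqr gtr0_norm ?divr_gt0//.
set Q := 1 + p^-1; set r := d / 2 * Num.sqrt Q.
have sQ : 0 < Num.sqrt Q by rewrite sqrtr_gt0.
have r0 : 0 < r by rewrite mulr_gt0// divr_gt0.
apply: le_trans (ler_wpM2l _ (phi_power_le r0)) _ => //.
have rE : r `^ (1 + p) = d / 2 * Num.sqrt Q * (d `^ p / 2 `^ p * Q `^ (p / 2)).
  rewrite powRD; last by rewrite gt_eqF.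
  rewrite powRr1 ?(ltW r0)//; congr (_ * _).
  rewrite /r powRM ?(ltW sQ)//; last by rewrite divr_ge0// ltW.
  rewrite powRM ?invr_ge0// ?(ltW d0)// powR_half.
  congr (_ * _); rewrite -powR12_sqrt ?(ltW Q0)// -powRrM; congr (_ `^ _); ring.
have sQE : Num.sqrt Q = Num.sqrt (1 + p) / Num.sqrt p.
  rewrite -sqrtrV ?(ltW p0)// -sqrtrM ?(ltW q0)//; congr Num.sqrt.
  by rewrite /Q; field; rewrite gt_eqF.
rewrite rE sQE wE ?(ltW d0)//.
have sq0 : 0 < Num.sqrt (1 + p) by rewrite sqrtr_gt0.
have sq2 : Num.sqrt (1 + p) ^+ 2 = 1 + p by rewrite sqr_sqrtr// ltW.
set S := Num.sqrt (1 + p) in sq0 sq2 *; rewrite -sq2.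
rewrite le_eqVlt; apply/orP; left; apply/eqP.
by field; rewrite !gt_eqF// powR_gt0.
Qed.

End power.

End corollary.

Theorem corollary1p8 (R : realType) (X : completeNormedModType R)
  (dot : {dot X for idfun}) (hdot : induces_norm dot)
  (w : R -> R) (hw : is_modulus w)
  (E : set X) (hE : E !=set0) (f : X -> R) (G : X -> X) :
  ((exists F : X -> R, C1w dot w F /\ jet_on dot E F f G) <->
     (Ajet dot w E f G < +oo)%E) /\
  ((Ajet dot w E f G < +oo)%E ->
     (Ajet dot w E f G <= jet_norm dot w E f G)%E /\
     (jet_norm dot w E f G <= (16 / Num.sqrt 15)%:E * Ajet dot w E f G)%E) /\
  (forall a : R, 0 < a -> a <= 1 -> (forall t : R, 0 <= t -> w t = t `^ a) ->
     (Ajet dot w E f G < +oo)%E ->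
     (Ajet dot w E f G <= jet_norm dot w E f G)%E /\
     (jet_norm dot w E f G <=
        (2 `^ (2 - 2 * a) / Num.sqrt (1 + a) * (1 + a^-1) `^ (a / 2))%:E
        * Ajet dot w E f G)%E).
Proof.
split; last split.
- split=> [[F [CF jF]]|Afin].
    apply: le_lt_trans (Ajet_le_Mw hdot hw CF jF) _.
    by have := Mw_fin hw CF; rewrite fin_numElt => /andP[].
  have [F [CF jF _]] := extension_of_consts hdot hw hE (doubling_const2 hw)
    (gradient_const_general hw) Afin.
  by exists F.
- move=> Afin; split; first exact: Ajet_le_jet_norm.
  have -> : 16 / Num.sqrt 15 = 2 * (8 / Num.sqrt 15) :> R by ring.
  exact: jet_norm_le (doubling_const2 hw) (gradient_const_general hw) Afin.
- move=> a a0 a1 wE Afin; split; first exact: Ajet_le_jet_norm.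
  have -> : 2 `^ (2 - 2 * a) / Num.sqrt (1 + a) * (1 + a^-1) `^ (a / 2) =
      2 / 2 `^ a * (2 / 2 `^ a / Num.sqrt (1 + a) * (1 + a^-1) `^ (a / 2)).
    have -> : 2 - 2 * a = (1 - a) + (1 - a) by ring.
    rewrite powRD ?pnatr_eq0 ?implybT// powRB ?pnatr_eq0 ?implybT// powRr1//.
    by ring.
  exact: jet_norm_le (doubling_const_power wE) (gradient_const_power hw a0 wE) Afin.
Qed.
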